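(* Let $\mathcal A=\{a_1,\ldots,a_n\}\subset\mathbb N^m$ be a list of nonzero vectors. Then $I_{\mathcal A}$ is a complete intersection if and only if either $\mathcal A_{red}=\emptyset$ or $I_{\mathcal A_{red}}$ is a complete intersection.
   Context: $k$ is an arbitrary field. For a finite list $\mathcal A=\{a_1,\ldots,a_n\}$ of nonzero vectors in $\mathbb N^m$, the toric ideal $I_{\mathcal A}\subset k[x_1,\ldots,x_n]$ is the kernel of the $k$-algebra homomorphism $x_i\mapsto t^{a_i}=t_1^{a_{i1}}\cdots t_m^{a_{im}}$ into $k[t_1,\ldots,t_m]$; its height is $n-\mathrm{rk}(\mathbb Z\mathcal A)$. An ideal is a complete intersection if its minimal number of generators equals its height. For a finite set $S$ of vectors, $\mathbb N S,\mathbb Z S,\mathbb Q S$ denote the sets of their nonnegative integer, integer and rational linear combinations. The reduced set $\mathcal A_{red}$ is the output of the following procedure: set $R:=\mathcal A$. Repeat: set $G:=R$; for each $a\in G$ in turn: remove $a$ from $R$; if $a\in\mathbb Q R$, let $B:=\min\{b\in\mathbb Z^+ : b\,a\in\mathbb Z R\}$ and, if $B\,a\notin\mathbb N R$, put $B\,a$ into $R$ (if $a\notin\mathbb QR$, or $B a\in\mathbb NR$, $a$ stays removed). Stop repeating when $R=\emptyset$ or $R=G$; then $\mathcal A_{red}:=R$. When nonempty, $\mathcal A_{red}=\{a'_1,\ldots,a'_r\}$ with $r\le n$ and $I_{\mathcal A_{red}}\subset k[x_1,\ldots,x_r]$ is its toric ideal. *)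

(* Defs.v *)
From HB Require Import structures.
From mathcomp Require Import all_boot all_order all_algebra.
From Stdlib Require Import ClassicalEpsilon.
Set Implicit Arguments. Unset Strict Implicit. Unset Printing Implicit Defensive.
Import Order.TTheory GRing.Theory Num.Theory.
Local Open Scope ring_scope.

Definition decP (P : Prop) : bool :=
  if excluded_middle_informative P then true else false.

Fixpoint mpoly (R : comNzRingType) (n : nat) : comNzRingType :=
  match n with
  | 0 => R
  | n'.+1 => ({poly mpoly R n'} : comNzRingType)
  end.

(* the variable x_i (i < n); the outermost polynomial variable is x_{n-1} *)
Fixpoint mvar (R : comNzRingType) (n : nat) (i : nat) : mpoly R n :=
  match n return mpoly R n with
  | 0 => 0
  | n'.+1 => if i == n' then 'X else (mvar R n' i)%:P
  end.

Fixpoint mconst (R : comNzRingType) (n : nat) (c : R) : mpoly R n :=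
  match n return mpoly R n with
  | 0 => c
  | n'.+1 => (mconst n' c)%:P
  end.

Fixpoint meval (R S : comNzRingType) (f : R -> S) (v : nat -> S) (n : nat)
  : mpoly R n -> S :=
  match n return mpoly R n -> S with
  | 0 => fun p => f p
  | n'.+1 => fun p => \sum_(i < size p) meval f v p`_i * v n' ^+ i
  end.

Definition generates (R : comNzRingType) (gs : seq R) (I : R -> Prop) : Prop :=
  forall p, I p <-> exists h : 'I_(size gs) -> R, p = \sum_(i < size gs) h i * gs`_i.

Definition min_num_gens (R : comNzRingType) (I : R -> Prop) (mu : nat) : Prop :=
  (exists gs : seq R, generates gs I /\ size gs = mu) /\
  (forall gs : seq R, generates gs I -> (mu <= size gs)%N).

Definition natvec (m : nat) (a : 'rV[int]_m) : bool := [forall j, 0 <= a 0 j].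

Definition ratvec (m : nat) (a : 'rV[int]_m) : 'rV[rat]_m :=
  map_mx (fun z : int => z%:~R) a.

Definition inQ (m : nat) (a : 'rV[int]_m) (R : seq 'rV[int]_m) : Prop :=
  exists c : 'I_(size R) -> rat, ratvec a = \sum_(i < size R) c i *: ratvec R`_i.
Definition inZ (m : nat) (a : 'rV[int]_m) (R : seq 'rV[int]_m) : Prop :=
  exists c : 'I_(size R) -> int, a = \sum_(i < size R) c i *: R`_i.
Definition inN (m : nat) (a : 'rV[int]_m) (R : seq 'rV[int]_m) : Prop :=
  exists c : 'I_(size R) -> int, (forall i, 0 <= c i) /\
    a = \sum_(i < size R) c i *: R`_i.

(* rank of the lattice ZA = dimension of its Q-span *)
Definition rkZ (m : nat) (A : seq 'rV[int]_m) : nat :=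
  \rank (\matrix_(i < size A, j < m) ratvec A`_i 0 j).

Definition tmon (k : fieldType) (m : nat) (a : 'rV[int]_m) : mpoly k m :=
  \prod_(j < m) mvar k m j ^+ `|a 0%R j|%N.

Definition toric_ideal (k : fieldType) (m : nat) (A : seq 'rV[int]_m)
  (p : mpoly k (size A)) : Prop :=
  meval (@mconst k m) (fun i => tmon k A`_i) p = 0.

(* I_A is a complete intersection: mu(I_A) = height(I_A) = n - rk(ZA) *)
Definition toric_ci (k : fieldType) (m : nat) (A : seq 'rV[int]_m) : Prop :=
  min_num_gens (@toric_ideal k m A) (size A - rkZ A)%N.

Definition Zmult (m : nat) (a : 'rV[int]_m) (R : seq 'rV[int]_m) (b : nat) : bool :=
  decP ((0 < b)%N /\ inZ (b%:Z *: a) R).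

(* B = min { b in Z^+ : b a in ZR } (0 if there is none; only used when a in QR) *)
Definition Bmin (m : nat) (a : 'rV[int]_m) (R : seq 'rV[int]_m) : nat :=
  match excluded_middle_informative (exists b, Zmult a R b) with
  | left H => ex_minn H
  | right _ => 0%N
  end.

Definition red_step (m : nat) (R : seq 'rV[int]_m) (a : 'rV[int]_m) : seq 'rV[int]_m :=
  let R1 := rem a R in
  if decP (inQ a R1) then
    let Ba := (Bmin a R1)%:Z *: a in
    if decP (inN Ba R1) then R1 else rcons R1 Ba
  else R1.

(* one pass of the "Repeat" loop: G := R, then process each a in G in turn *)
Definition red_pass (m : nat) (G : seq 'rV[int]_m) : seq 'rV[int]_m :=
  foldl (@red_step m) G G.

(* the loop stops after pass number K.+1 (iterates X_j = red_pass^j A) *)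
Definition red_stops (m : nat) (A : seq 'rV[int]_m) (K : nat) : Prop :=
  let X := fun j => iter j (@red_pass m) A in
  X K.+1 = [::] \/ perm_eq (X K.+1) (X K).

Definition is_Ared (m : nat) (A Ared : seq 'rV[int]_m) : Prop :=
  exists K, red_stops A K /\ (forall j, (j < K)%N -> ~ red_stops A j) /\
    Ared = iter K.+1 (@red_pass m) A.

(* Main.v *)
Require Import Defs.
From HB Require Import structures.
From mathcomp Require Import all_boot all_order all_algebra.
From Stdlib Require Import ClassicalEpsilon.
Set Implicit Arguments. Unset Strict Implicit. Unset Printing Implicit Defensive.
Import Order.TTheory GRing.Theory Num.Theory.
Local Open Scope ring_scope.

(** Every single replacement step of the reduction preserves the complete
    intersection property.  Let [a] be the vector treated and [R] the others.
    If [a] is not in [QR], then [I_(R+a)] is the extension of [I_R], and number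
    of vectors and rank both drop by one.  If [a] is in [QR], substituting
    [y^B] for the last variable [y] maps generators of [I_(R+Ba)] to generators
    of [I_(R+a)]; and if [Ba] is in [NR], with monomial [M], then [I_(R+Ba)] is
    generated by [I_R] and [y - M].  To compare minimal numbers of generators
    in the other direction one passes to the vector space [I / m I], where [m]
    is generated by the variables: toric ideals are graded with variables of
    positive degree, so by Nakayama [I] has [s] generators as soon as
    [I / m I] is spanned by [s] elements. *)

(** * Iterated polynomials *)

Lemma mconst_zmod_morphism (R : comNzRingType) n : zmod_morphism (@mconst R n).
Proof. by elim: n => [|n IHn] x y //=; rewrite IHn polyCB. Qed.

Lemma mconst_monoid_morphism (R : comNzRingType) n : monoid_morphism (@mconst R n).
Proof.
elim: n => [|n [IH1 IHM]]; split=> //= [|x y]; first by rewrite IH1.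
by rewrite IHM polyCM.
Qed.

HB.instance Definition _ (R : comNzRingType) n :=
  GRing.isZmodMorphism.Build R (mpoly R n) (@mconst R n) (@mconst_zmod_morphism R n).
HB.instance Definition _ (R : comNzRingType) n :=
  GRing.isMonoidMorphism.Build R (mpoly R n) (@mconst R n) (@mconst_monoid_morphism R n).

Arguments meval : simpl never.

Lemma mevalS (R S : comNzRingType) (f : R -> S) v n (p : mpoly R n.+1) :
  meval f v p = (map_poly (meval f v (n:=n)) p).[v n].
Proof. by rewrite /map_poly horner_poly. Qed.

Section Meval.
Variables (R S : comNzRingType) (f : {rmorphism R -> S}) (v : nat -> S).

(** Additivity and multiplicativity are proved together: the inductive step packs [meval] in [n]
    variables as a ring morphism, so that [map_poly] of it is one too. *)
Lemma meval_zmod_monoid_morphism n :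
  zmod_morphism (@meval R S f v n) * monoid_morphism (@meval R S f v n).
Proof.
elim: n => [|n [IHB IHM]].
  by split; [exact: rmorphB | split; [exact: rmorph1 | exact: rmorphM]].
pose A := GRing.isZmodMorphism.Build _ _ _ IHB.
pose M := GRing.isMonoidMorphism.Build _ _ _ IHM.
pose F : {rmorphism mpoly R n -> S} := HB.pack (meval f v (n:=n)) A M.
have E p : meval f v (n:=n.+1) p = (map_poly F p).[v n] by rewrite mevalS.
split; first by move=> p q; rewrite !E rmorphB hornerD hornerN.
split; first by rewrite E rmorph1 hornerC.
by move=> p q; rewrite !E rmorphM hornerM.
Qed.

HB.instance Definition _ n :=
  GRing.isZmodMorphism.Build (mpoly R n) S (@meval R S f v n)
    (meval_zmod_monoid_morphism n).1.
HB.instance Definition _ n :=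
  GRing.isMonoidMorphism.Build (mpoly R n) S (@meval R S f v n)
    (meval_zmod_monoid_morphism n).2.

Lemma meval_mconst n c : meval f v (@mconst R n c) = f c.
Proof. by elim: n => [|n IHn] //; rewrite mevalS map_polyC hornerC. Qed.

Lemma meval_mvar n i : (i < n)%N -> meval f v (mvar R n i) = v i.
Proof.
elim: n => [|n IHn] // ltin; rewrite mevalS /=.
case: eqVneq => [->|nein]; first by rewrite map_polyX hornerX.
by rewrite map_polyC hornerC /= IHn // ltn_neqAle nein.
Qed.

Lemma mevalC n (p : mpoly R n) : meval f v (n:=n.+1) p%:P = meval f v p.
Proof. by rewrite mevalS map_polyC hornerC. Qed.

Lemma mevalX n : meval f v (n:=n.+1) 'X = v n.
Proof. by rewrite mevalS map_polyX hornerX. Qed.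

End Meval.

(** Constants and variables generate the ring; identities between composite substitutions are
    checked on these generators. *)
Lemma rmorph_mpoly_ext (R S : comNzRingType) n (F G : {rmorphism mpoly R n -> S}) :
    (forall c, F (mconst n c) = G (mconst n c)) ->
    (forall i, (i < n)%N -> F (mvar R n i) = G (mvar R n i)) ->
  F =1 G.
Proof.
elim: n F G => [|n IHn] F G eqC eqX p; first exact: eqC.
pose F' : {rmorphism mpoly R n -> S} := F \o polyC.
pose G' : {rmorphism mpoly R n -> S} := G \o polyC.
have eqFG : F' =1 G'.
  apply: IHn => [c|i ltin]; first exact: eqC.
  have := eqX i (leqW ltin); rewrite /= ifN //.
  by rewrite neq_ltn ltin.
have eqFX : F 'X = G 'X by have := eqX n (leqnn _); rewrite /= eqxx.
rewrite -[p]coefK poly_def !rmorph_sum; apply: eq_bigr => i _.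
by rewrite -mul_polyC !rmorphM !rmorphXn [F _](eqFG p`_i) eqFX.
Qed.

Lemma eq_meval (R S : comNzRingType) (f : {rmorphism R -> S}) u v n (p : mpoly R n) :
  (forall i, (i < n)%N -> u i = v i) -> meval f u p = meval f v p.
Proof.
move=> equv; apply: rmorph_mpoly_ext => [c|i ltin]; rewrite /= ?meval_mconst //.
by rewrite !meval_mvar ?equv.
Qed.

(** * Generators of an ideal and graded Nakayama *)

(** Generators are the first [s] values of a function on [nat], so that families of different
    lengths compare without casts. *)
Definition in_ideal (R : comNzRingType) (g : nat -> R) (s : nat) (p : R) : Prop :=
  exists h : nat -> R, p = \sum_(i < s) h i * g i.

Definition gen_by (R : comNzRingType) (I : R -> Prop) (s : nat) : Prop :=
  exists g : nat -> R, forall p, I p <-> in_ideal g s p.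

Lemma ord_fun_nat (T : Type) (x0 : T) s (h : 'I_s -> T) :
  exists h' : nat -> T, forall i : 'I_s, h' i = h i.
Proof. by exists (fun j => if insub j is Some i then h i else x0) => i; rewrite valK. Qed.

Lemma gen_by_generates (R : comNzRingType) (I : R -> Prop) s :
  gen_by I s <-> exists gs, generates gs I /\ size gs = s.
Proof.
split=> [[g gP] | [gs [gsP <-]]].
  exists (mkseq g s); split; last by rewrite size_mkseq.
  have E (h : nat -> R) : \sum_(i < size (mkseq g s)) h i * (mkseq g s)`_i
                        = \sum_(i < s) h i * g i.
    by rewrite size_mkseq; apply: eq_bigr => i _; rewrite nth_mkseq.
  move=> p; split=> [/gP[h ->]|[h ->]]; first by exists (fun i => h i); rewrite E.
  have [h' h'E] := ord_fun_nat 0 h.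
  apply/gP; exists h'; rewrite -E; apply: eq_bigr => i _.
  by rewrite h'E.
exists (nth 0 gs) => p; split=> [/gsP[h ->]|[h ->]].
  have [h' h'E] := ord_fun_nat 0 h.
  by exists h'; apply: eq_bigr => i _; rewrite h'E.
by apply/gsP; exists (fun i => h i).
Qed.

Section InIdeal.
Variables (R : comNzRingType) (g : nat -> R) (s : nat).

Lemma in_ideal0 : in_ideal g s 0.
Proof. by exists (fun=> 0); rewrite big1 // => i _; rewrite mul0r. Qed.

Lemma in_idealD p q : in_ideal g s p -> in_ideal g s q -> in_ideal g s (p + q).
Proof.
move=> [h ->] [h' ->]; exists (fun i => h i + h' i).
by rewrite -big_split; apply: eq_bigr => i _; rewrite mulrDl.
Qed.

Lemma in_idealM p q : in_ideal g s q -> in_ideal g s (p * q).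
Proof.
move=> [h ->]; exists (fun i => p * h i).
by rewrite mulr_sumr; apply: eq_bigr => i _; rewrite mulrA.
Qed.

Lemma in_ideal_sum (T : Type) (r : seq T) (Q : pred T) F :
  (forall i, Q i -> in_ideal g s (F i)) -> in_ideal g s (\sum_(i <- r | Q i) F i).
Proof. by move=> IF; elim/big_ind: _ => //; [exact: in_ideal0 | exact: in_idealD]. Qed.

Lemma in_ideal_gen i : (i < s)%N -> in_ideal g s (g i).
Proof.
move=> ltis; exists (fun j => (j == i)%:R).
rewrite (bigD1 (Ordinal ltis)) //= eqxx mul1r big1 ?addr0 // => j neji.
by rewrite -val_eqE /= in neji; rewrite (negPf neji) mul0r.
Qed.

Lemma in_ideal_sub g' s' p :
  (forall i, (i < s)%N -> in_ideal g' s' (g i)) -> in_ideal g s p -> in_ideal g' s' p.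
Proof.
move=> gg' [h ->].
elim/big_ind: _ => [|x y [h1 ->] [h2 ->]|i _].
- by exists (fun=> 0); rewrite big1 // => i _; rewrite mul0r.
- exists (fun i => h1 i + h2 i).
  by rewrite -big_split; apply: eq_bigr => i _; rewrite mulrDl.
have [h' ->] := gg' i (ltn_ord i); exists (fun j => h i * h' j).
by rewrite mulr_sumr; apply: eq_bigr => j _; rewrite mulrA.
Qed.

End InIdeal.

Lemma in_ideal_rmorph (R S : comNzRingType) (F : {rmorphism R -> S}) g s p :
  in_ideal g s p -> in_ideal (F \o g) s (F p).
Proof.
move=> [h ->]; exists (F \o h).
by rewrite rmorph_sum; apply: eq_bigr => i _; rewrite rmorphM.
Qed.

(** An element [q] of [J] is [F (G q)] with [G q] in [I], so the images under [F] of generators of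
    [I] suffice. This serves for renaming variables and for setting the last variable to 0. *)
Lemma gen_by_retract (R S : comNzRingType) (I : R -> Prop) (J : S -> Prop)
    (F : {rmorphism R -> S}) (G : S -> R) s :
    cancel G F -> (forall p, I p -> J (F p)) -> (forall q, J q -> I (G q)) ->
    (forall h q, J q -> J (h * q)) -> (forall p q, J p -> J q -> J (p + q)) -> J 0 ->
  gen_by I s -> gen_by J s.
Proof.
move=> GK IJ JI JM JD J0 [g gP]; exists (F \o g) => q; split=> [/JI/gP|[h ->]].
  by move=> /(in_ideal_rmorph F); rewrite GK.
elim/big_ind: _ => // i _; apply: JM; apply: IJ.
by apply/gP/in_ideal_gen.
Qed.

(** * Spanning sets of [I / m I] and Nakayama for graded kernels *)

Section Nakayama.
Variables (k : fieldType) (P Q : comNzRingType).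
Variables (c : {rmorphism k -> P}) (e : {rmorphism P -> k}) (F : {rmorphism P -> Q}).
Hypothesis cK : cancel c e.

(* The product [m I] of the augmentation ideal [m = ker e] with [I = ker F]. *)
Inductive aug_mul_ker : P -> Prop :=
| aug_mul_ker0 : aug_mul_ker 0
| aug_mul_kerD m q r : e m = 0 -> F q = 0 -> aug_mul_ker r -> aug_mul_ker (m * q + r).

Lemma aug_mul_kerM m q : e m = 0 -> F q = 0 -> aug_mul_ker (m * q).
Proof. by move=> em Fq; rewrite -[_ * q]addr0; apply: aug_mul_kerD => //; left. Qed.

Lemma aug_mul_ker_add p q : aug_mul_ker p -> aug_mul_ker q -> aug_mul_ker (p + q).
Proof.
move=> + mq; elim=> [|m p' r em Fp _ IH]; first by rewrite add0r.
by rewrite -addrA; apply: aug_mul_kerD.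
Qed.

Lemma aug_mul_ker_mul p q : aug_mul_ker q -> aug_mul_ker (p * q).
Proof.
elim=> [|m q' r em Fq _ IH]; first by rewrite mulr0; left.
by rewrite mulrDr mulrA; apply: aug_mul_kerD; rewrite ?rmorphM ?em ?mulr0.
Qed.

Definition spanned (T : finType) (f : T -> P) (p : P) : Prop :=
  exists a : T -> k, aug_mul_ker (p - \sum_i c (a i) * f i).

Section Spanned.
Variables (T : finType) (f : T -> P).

Lemma spanned_mul_ker p : aug_mul_ker p -> spanned f p.
Proof.
by exists (fun=> 0); rewrite big1 ?subr0 // => i _; rewrite rmorph0 mul0r.
Qed.

Lemma spannedD p q : spanned f p -> spanned f q -> spanned f (p + q).
Proof.
move=> [a ap] [b bq]; exists (fun i => a i + b i).
rewrite [X in _ - X](_ : _ = \sum_i c (a i) * f i + \sum_i c (b i) * f i).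
  by rewrite opprD addrACA; apply: aug_mul_ker_add.
by rewrite -big_split; apply: eq_bigr => i _; rewrite rmorphD mulrDl.
Qed.

Lemma spannedZ x p : spanned f p -> spanned f (c x * p).
Proof.
move=> [a ap]; exists (fun i => x * a i).
rewrite [X in _ - X](_ : _ = c x * \sum_i c (a i) * f i).
  by rewrite -mulrBr; apply: aug_mul_ker_mul.
by rewrite mulr_sumr; apply: eq_bigr => i _; rewrite rmorphM mulrA.
Qed.

Lemma spanned_sum (X : Type) (r : seq X) (G : X -> P) :
  (forall i, spanned f (G i)) -> spanned f (\sum_(i <- r) G i).
Proof.
move=> fG; elim/big_ind: _ => //; last exact: spannedD.
exact/spanned_mul_ker/aug_mul_ker0.
Qed.

Lemma spanned_mem i : spanned f (f i).
Proof.
exists (fun j => (j == i)%:R); rewrite (bigD1 i) //= eqxx rmorph1 mul1r.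
rewrite big1 => [|j /negPf ->]; last by rewrite rmorph0 mul0r.
by rewrite addr0 subrr; left.
Qed.

End Spanned.

Lemma spanned_trans (T U : finType) (f : T -> P) (g : U -> P) p :
  (forall i, spanned g (f i)) -> spanned f p -> spanned g p.
Proof.
move=> gf [a ap]; rewrite -[p](subrK (\sum_i c (a i) * f i)).
apply: spannedD; first exact: spanned_mul_ker.
by apply: spanned_sum => i; apply: spannedZ.
Qed.

(* [f] spans the [k]-space [I / m I], where [I = ker F]. *)
Definition spans_ker (T : finType) (f : T -> P) : Prop :=
  (forall i, F (f i) = 0) /\ forall p, F p = 0 -> spanned f p.

(** Each coefficient [h i] is the constant [c (e (h i))] plus an element of [m], and the latter
    contributes only to [m I]. *)
Lemma gen_by_spans_ker s :
  gen_by (fun p => F p = 0) s -> exists f : 'I_s -> P, spans_ker f.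
Proof.
move=> [g gP]; exists (fun i => g i); split=> [i|p /gP[h ->]].
  by apply/gP/in_ideal_gen.
apply: spanned_sum => i; rewrite -[h i](subrK (c (e (h i)))) mulrDl.
apply: spannedD; last by apply: spannedZ; apply: (spanned_mem (fun i : 'I_s => g i)).
apply/spanned_mul_ker/aug_mul_kerM; last by apply/gP/in_ideal_gen.
by rewrite rmorphB /= cK subrr.
Qed.

Lemma spans_ker_drop s (f : 'I_s.+1 -> P) (a : 'I_s.+1 -> k) i0 :
    a i0 != 0 -> aug_mul_ker (\sum_i c (a i) * f i) -> spans_ker f ->
  spans_ker (f \o lift i0).
Proof.
move=> ai0 af [kf sf]; split=> [i|p /sf]; first exact: kf.
apply: spanned_trans => i; case: (unliftP i0 i) => [j ->|->].
  exact: (spanned_mem (f \o lift i0)).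
have -> : f i0 = c (a i0)^-1 * (\sum_i c (a i) * f i)
              + c (- (a i0)^-1) * \sum_j c (a (lift i0 j)) * f (lift i0 j).
  rewrite (bigD1_ord i0) //= mulrDr mulrA -rmorphM mulVf // rmorph1 mul1r.
  by rewrite rmorphN mulNr addrK.
apply: spannedD; first exact/spanned_mul_ker/aug_mul_ker_mul.
apply/spannedZ/spanned_sum => j.
exact/spannedZ/(spanned_mem (f \o lift i0)).
Qed.

(** Coordinates of the [H x] with respect to [f], chosen modulo [m I], form a matrix with [s]
    columns. A maximal independent set of its rows has at most [s] members, and a linear relation
    between rows gives one between the [H x] modulo [m I]. *)
Lemma spans_ker_extract s (f : 'I_s -> P) (X : finType) (H : X -> P) :
    spans_ker f -> (forall x, F (H x) = 0) -> (forall i, spanned H (f i)) ->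
  exists r, exists2 g : 'I_r -> X, (r <= s)%N & spans_ker (H \o g).
Proof.
move=> [kf sf] kH Hf.
have /fin_all_exists[a aP] x : exists a : 'I_s -> k,
    aug_mul_ker (H x - \sum_i c (a i) * f i) by exact: sf.
pose C := \matrix_(y < #|X|, i < s) a (enum_val y) i.
pose g i := enum_val (maxrankfun C i).
exists (\rank C), g; first exact: rank_leq_col.
split=> [i|p /sf]; first exact: kH.
move/(spanned_trans Hf); apply: spanned_trans => x.
have /submxP[D CD] : (C <= rowsub (maxrankfun C) C)%MS.
  by rewrite (eq_maxrowsub C).
have aE l : a x l = \sum_j D (enum_rank x) j * a (g j) l.
  have := congr1 (fun M : 'M_(_, _) => M (enum_rank x) l) CD.
  rewrite !mxE enum_rankK => ->; apply: eq_bigr => j _.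
  by rewrite !mxE.
rewrite -[H x](subrK (\sum_i c (a x i) * f i)).
apply: spannedD; first exact: spanned_mul_ker.
have -> : \sum_i c (a x i) * f i =
    \sum_j c (D (enum_rank x) j) * \sum_i c (a (g j) i) * f i.
  transitivity (\sum_i \sum_j c (D (enum_rank x) j) * (c (a (g j) i) * f i)).
    apply: eq_bigr => i _; rewrite aE rmorph_sum mulr_suml.
    by apply: eq_bigr => j _; rewrite rmorphM mulrA.
  by rewrite exchange_big; apply: eq_bigr => j _; rewrite mulr_sumr.
apply: spanned_sum => j; apply: spannedZ.
rewrite -[X in spanned _ X](subKr (H (g j))) -mulN1r -(rmorph1 c) -rmorphN.
apply: spannedD; first exact: (spanned_mem (H \o g)).
exact/spannedZ/spanned_mul_ker.
Qed.

(* A grading of [P] by natural numbers: the component of degree [d] of [p] is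
   the coefficient of ['X^d] in [grad p]. *)
Variable grad : {rmorphism P -> {poly P}}.
Hypothesis grad1 : forall p, (grad p).[1] = p.
Hypothesis grad_coef : forall p d, grad (grad p)`_d = (grad p)`_d *: 'X^d.
Hypothesis grad0 : forall p, (grad p)`_0 = c (e p).
Hypothesis grad_ker : forall p d, F p = 0 -> F (grad p)`_d = 0.

Lemma sum_grad p : p = \sum_(d < size (grad p)) (grad p)`_d.
Proof.
rewrite -{1}[p]grad1 horner_coef; apply: eq_bigr => d _.
by rewrite expr1n mulr1.
Qed.

(** Strong induction on the degree of a component. Modulo [m I] the element is a combination of the
    homogeneous [f i], whose components are 0 or [f i] itself; a component of an element of [m I]
    involves only components of kernel elements in lower degree. *)
Lemma homogeneous_spans_ker_in_ideal s (f : nat -> P) (deg : nat -> nat) p :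
    spans_ker (fun i : 'I_s => f i) ->
    (forall i, (i < s)%N -> grad (f i) = f i *: 'X^(deg i)) ->
  F p = 0 -> in_ideal f s p.
Proof.
move=> [kf sf] hf Fp; rewrite [p]sum_grad; apply: in_ideal_sum => -[/= d _] _.
elim/ltn_ind: d p Fp => d IHd p /sf[a ap].
rewrite -[p](subrK (\sum_i c (a i) * f i)) rmorphD coefD; apply: in_idealD.
  elim: ap => [|m q r em Fq _ IHr]; first by rewrite rmorph0 coef0; apply: in_ideal0.
  rewrite rmorphD coefD; apply: in_idealD => //.
  (* The degree 0 component of [m] is [c (e m) = 0]; its component of degree [j.+1] meets one of [q]
     of degree [d - j.+1], covered by induction. *)
  rewrite rmorphM coefM; apply: in_ideal_sum => -[[|j] /= ltjd] _.
    by rewrite grad0 em rmorph0 mul0r; apply: in_ideal0.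
  by apply/in_idealM/IHd; rewrite // ltn_subrL; case: (d) ltjd.
rewrite rmorph_sum coef_sum; apply: in_ideal_sum => i _.
rewrite rmorphM coefM; apply: in_ideal_sum => j _; apply: in_idealM.
rewrite hf // coefZ coefXn mulrC; apply/in_idealM/in_ideal_gen; exact: ltn_ord.
Qed.

(** The homogeneous components of the [f i] lie in the kernel and still span; at most [s] of them
    already do, and these generate by induction on the degree. *)
Lemma graded_nakayama s (f : 'I_s -> P) :
  spans_ker f -> gen_by (fun p => F p = 0) s.
Proof.
move=> sf; have [kf _] := sf.
pose X := {i : 'I_s & 'I_(size (grad (f i)))}.
pose H (x : X) := (grad (f (tag x)))`_(tagged x).
have [x|i|r [g lers sH]] := spans_ker_extract sf (H := H).
- exact/grad_ker.
- rewrite [f i]sum_grad; apply: spanned_sum => d.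
  exact: (spanned_mem H (Tagged (fun i => 'I_(size (grad (f i)))) d)).
have [h hE] := ord_fun_nat 0 (H \o g).
have [deg degE] := ord_fun_nat 0%N (fun i : 'I_r => tagged (g i) : nat).
(* Zeros pad the [r <= s] homogeneous generators to exactly [s]. *)
exists (fun i => if (i < r)%N then h i else 0) => p; split=> [Fp|[a ->]]; last first.
  rewrite rmorph_sum big1 // => i _; rewrite rmorphM.
  case: ifP => [ltir|_]; last by rewrite rmorph0 mulr0.
  by rewrite (hE (Ordinal ltir)) /= [X in _ * X]grad_ker ?mulr0.
have : in_ideal h r p.
  apply: (@homogeneous_spans_ker_in_ideal r h deg) => // [|i ltir].
    by case: sH => kH sH; split=> [i|q /sH[a aq]]; rewrite ?hE //; exists a;
       under eq_bigr do rewrite hE.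
  by rewrite (hE (Ordinal ltir)) (degE (Ordinal ltir)) /= [LHS]grad_coef.
apply: in_ideal_sub => i ltir.
have := in_ideal_gen (fun i => if (i < r)%N then h i else 0) (leq_trans ltir lers).
by rewrite ltir.
Qed.

End Nakayama.

(** * Monomials and the grading *)

Lemma meval_poly (R S : comNzRingType) (f : {rmorphism R -> S}) v n N (E : nat -> mpoly R n) :
  meval f v (n:=n.+1) (\poly_(j < N) E j) = \sum_(j < N) meval f v (E j) * v n ^+ j.
Proof.
rewrite poly_def rmorph_sum; apply: eq_bigr => j _.
by rewrite -mul_polyC rmorphM rmorphXn /= mevalC mevalX.
Qed.

Lemma meval_closed (R S : comNzRingType) (f : {rmorphism R -> S}) v n (K : S -> Prop) :
    K 0 -> (forall x y, K x -> K y -> K (x + y)) ->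
    (forall x y, K x -> K y -> K (x * y)) ->
    (forall c, K (f c)) -> (forall i, (i < n)%N -> K (v i)) ->
  forall p, K (@meval R S f v n p).
Proof.
move=> K0 KD KM Kf; elim: n => [|n IHn] Kv p; first exact: Kf.
rewrite mevalS /map_poly horner_poly.
apply: (big_ind K) => // i _; apply: (KM); first by apply: IHn => j ltjn; apply: Kv (leqW _).
elim: (nat_of_ord i) => [|j IHj]; first by rewrite expr0 -(rmorph1 f).
by rewrite exprS; apply: (KM) => //; apply: Kv.
Qed.

(* [mcoef u p] is the coefficient in [p] of the monomial [\prod_i x_i ^ u i]. *)
Fixpoint mcoef (R : comNzRingType) (n : nat) (u : nat -> nat) : mpoly R n -> R :=
  match n return mpoly R n -> R with
  | 0 => id
  | n'.+1 => fun p => mcoef u p`_(u n')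
  end.

Section Mcoef.
Variable R : comNzRingType.

Lemma mcoef_zmod_morphism n u : zmod_morphism (@mcoef R n u).
Proof. by elim: n => [|n IHn] p q //=; rewrite coefB IHn. Qed.

HB.instance Definition _ n u :=
  GRing.isZmodMorphism.Build (mpoly R n) R (@mcoef R n u) (@mcoef_zmod_morphism n u).

Lemma mcoef0 n u : mcoef u (0 : mpoly R n) = 0.
Proof. exact: (raddf0 (@mcoef R n u)). Qed.

Lemma mcoef_sum n u (I : Type) (r : seq I) (P : pred I) (E : I -> mpoly R n) :
  mcoef u (\sum_(i <- r | P i) E i) = \sum_(i <- r | P i) mcoef u (E i).
Proof. exact: (raddf_sum (@mcoef R n u)). Qed.

Lemma eq_mcoef n (p : mpoly R n) u v :
  (forall i, (i < n)%N -> u i = v i) -> mcoef u p = mcoef v p.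
Proof.
elim: n p => [|n IHn] p //= equv; rewrite equv //; apply: IHn => i ltin.
exact/equv/leqW.
Qed.

Lemma mcoef_inj0 n (p : mpoly R n) : (forall u, mcoef u p = 0) -> p = 0.
Proof.
elim: n p => [|n IHn] p /= p0; first exact: p0 id.
apply/polyP => i; rewrite coef0; apply: IHn => u.
rewrite -(p0 (fun j => if j == n then i else u j)) eqxx; apply: eq_mcoef => j ltjn.
by rewrite ifN // neq_ltn ltjn.
Qed.

Lemma mcoefM_neq0 n (p q : mpoly R n) u : mcoef u (p * q) != 0 ->
  exists v w, [/\ mcoef v p != 0, mcoef w q != 0 & forall i, (i < n)%N -> u i = (v i + w i)%N].
Proof.
elim: n p q => [|n IHn] p q /= nz0.
  by exists id, id; split=> //; apply: contraNneq nz0 => ->; rewrite ?mul0r ?mulr0.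
move: nz0; rewrite coefM mcoef_sum => nz0.
have [i nzi] : exists i : 'I_(u n).+1, mcoef u (p`_i * q`_(u n - i)) != 0.
  apply/existsP; apply: contraNT nz0; rewrite negb_exists => /forallP z.
  by rewrite big1 // => i _; apply/eqP; rewrite -[_ == _]negbK z.
have [v [w [pv qw uE]]] := IHn _ _ nzi.
exists (fun j => if j == n then i : nat else v j).
exists (fun j => if j == n then (u n - i)%N else w j).
have ltE (j : nat) : (j < n)%N -> (j == n) = false by move=> ltjn; rewrite ltn_eqF.
rewrite !eqxx; split=> [||j].
- by rewrite -(@eq_mcoef _ _ v) // => j /ltE->.
- by rewrite -(@eq_mcoef _ _ w) // => j /ltE->.
rewrite ltnS leq_eqVlt; case: eqVneq => [-> _|_ /= /uE //].
by rewrite subnKC // -ltnS.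
Qed.

Lemma mcoef_mconst n (c : R) u :
  mcoef u (mconst n c) != 0 -> forall i, (i < n)%N -> u i = 0%N.
Proof.
elim: n => [|n IHn] //=; rewrite coefC; case: (u n =P 0%N) => [u0|_]; last by rewrite mcoef0 eqxx.
move=> /IHn un i; rewrite ltnS leq_eqVlt; case: eqVneq => [-> //|_ /=]; exact: un.
Qed.

Lemma mcoef_mvar n i u :
  mcoef u (mvar R n i) != 0 -> forall j, (j < n)%N -> u j = (j == i).
Proof.
elim: n => [|n IHn] //=; case: (eqVneq i n) => [->|nein].
  rewrite coefX; case: (u n =P 1%N) => [u1|_]; last by rewrite mcoef0 eqxx.
  rewrite -(rmorph1 (@mconst R n)) => /mcoef_mconst u0 j.
  by rewrite ltnS leq_eqVlt; case: eqVneq => [-> //|_ /= /u0].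
rewrite coefC; case: (u n =P 0%N) => [u0|_]; last by rewrite mcoef0 eqxx.
move=> /IHn un j; rewrite ltnS leq_eqVlt; case: (eqVneq j n) => [-> _|_ /=]; last exact: un.
by rewrite eq_sym (negPf nein).
Qed.

Definition supported m (S : 'rV[int]_m -> Prop) (p : mpoly R m) : Prop :=
  forall u, mcoef u p != 0 -> S (\row_j (u j)%:Z).

Lemma supported0 m (S : 'rV[int]_m -> Prop) : supported S 0.
Proof. by move=> u; rewrite mcoef0 eqxx. Qed.

Lemma supportedD m (S : 'rV[int]_m -> Prop) p q :
  supported S p -> supported S q -> supported S (p + q).
Proof.
move=> Sp Sq u; rewrite (raddfD (@mcoef R m u)) /=.
have [->|/Sp //] := eqVneq (mcoef u p) 0.
by rewrite add0r => /Sq.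
Qed.

Lemma supportedM m (S T U : 'rV[int]_m -> Prop) p q :
    (forall x y, S x -> T y -> U (x + y)) ->
  supported S p -> supported T q -> supported U (p * q).
Proof.
move=> STU Sp Tq u /mcoefM_neq0[v [w [/Sp Sv /Tq Tw uE]]].
rewrite (_ : \row_j _ = \row_j (v j)%:Z + \row_j (w j)%:Z); first exact: STU.
by apply/rowP => j; rewrite !mxE uE // PoszD.
Qed.

Lemma supported_mconst m c : supported (eq^~ 0) (mconst m c : mpoly R m).
Proof.
by move=> u /mcoef_mconst u0; apply/rowP => j; rewrite !mxE u0.
Qed.

Lemma supported_mvar m (i : 'I_m) : supported (eq^~ (delta_mx 0 i)) (mvar R m i).
Proof.
by move=> u /mcoef_mvar u0; apply/rowP => j; rewrite !mxE u0 // -val_eqE natz.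
Qed.

Lemma supportedX m x (p : mpoly R m) d :
  supported (eq^~ x) p -> supported (eq^~ (d%:Z *: x)) (p ^+ d).
Proof.
move=> Sp; elim: d => [|d IHd].
  by rewrite expr0 scale0r -(rmorph1 (@mconst R m)); apply: supported_mconst.
rewrite exprS; apply: supportedM Sp IHd => _ _ -> ->.
by rewrite -[X in X + _]scale1r -scalerDl intS.
Qed.

End Mcoef.

(** [tmon] takes absolute values of the entries; nonnegativity makes the exponent vector equal to
    [a]. *)
Lemma supported_tmon (k : fieldType) m (a : 'rV[int]_m) :
  natvec a -> supported (eq^~ a) (tmon k a).
Proof.
move/forallP=> a0; rewrite {1}[a]row_sum_delta.
rewrite /tmon; apply: (big_ind2 (fun x p => supported (eq^~ x) p)).
- by rewrite -(rmorph1 (@mconst k m)); apply: supported_mconst.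
- by move=> x p y q Sp Sq; apply: supportedM Sp Sq => _ _ -> ->.
move=> j _; rewrite -{1}[a 0 j]gez0_abs //.
exact/supportedX/supported_mvar.
Qed.

Section Tmon.
Variables (k : fieldType) (m : nat).
Implicit Types a b : 'rV[int]_m.

Lemma tmon0 : tmon k (0 : 'rV[int]_m) = 1.
Proof. by rewrite /tmon big1 // => j _; rewrite mxE expr0. Qed.

Lemma tmonD a b : natvec a -> natvec b -> tmon k (a + b) = tmon k a * tmon k b.
Proof.
move=> /forallP a0 /forallP b0; rewrite /tmon -big_split; apply: eq_bigr => j _.
rewrite /= -exprD mxE; congr (_ ^+ _).
by apply/eqP; rewrite -eqz_nat PoszD !gez0_abs ?addr_ge0.
Qed.

Lemma tmonZ a (z : int) : tmon k (z *: a) = tmon k a ^+ `|z|.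
Proof.
rewrite /tmon -prodrXl; apply: eq_bigr => j _.
by rewrite mxE abszM mulnC exprM.
Qed.

(** [mpoly] is declared only as a commutative ring, so monomials are cancelled through regularity of
    the variables. *)
Lemma lreg_mvar n i : (i < n)%N -> GRing.lreg (mvar k n i).
Proof.
elim: n => [|n IHn] //= ltin; case: eqVneq => [_|nein].
  exact/monic_lreg/monicX.
have reg : GRing.lreg (mvar k n i) by apply: IHn; rewrite ltn_neqAle nein.
move=> p q /polyP eqpq; apply/polyP => j; apply: reg.
by have := eqpq j; rewrite !coefCM.
Qed.

Lemma lreg_tmon a : GRing.lreg (tmon k a).
Proof.
apply: (big_ind (@GRing.lreg _)) => [|x y|j _]; first exact: lreg1.
  exact: lregM.
exact/lregX/lreg_mvar.
Qed.

Lemma neq0_entry a : a != 0 -> exists j, a 0 j != 0.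
Proof.
move=> nza; apply/existsP; apply: contraNT nza; rewrite negb_exists => /forallP a0.
by apply/eqP/rowP => j; rewrite mxE; apply/eqP; rewrite -[_ == _]negbK a0.
Qed.

End Tmon.

(** Evaluation at the origin; its kernel is the ideal [m] generated by the variables. *)
Notation aug k n := (@meval k k idfun (fun=> 0) n).

Notation toric_map k v n := (@meval k _ (@mconst k _) (fun i => tmon k (v i)) n).

Lemma aug_tmon (k : fieldType) m (a : 'rV[int]_m) : a != 0 -> aug k m (tmon k a) = 0.
Proof.
move=> /neq0_entry[j nzaj]; rewrite /tmon (bigD1 j) //= rmorphM rmorphXn /=.
by rewrite meval_mvar // expr0n absz_eq0 (negPf nzaj) mul0r.
Qed.

(** * Gradings by weights on the variables *)

Section Grading.
Variables (k : fieldType) (n : nat) (w : nat -> nat).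

(** The new variable records the weighted degree, so the coefficients of the image of [p] are its
    homogeneous components. *)
Definition wgrad : mpoly k n -> {poly mpoly k n} :=
  @meval k _ (polyC \o @mconst k n) (fun i => mvar k n i *: 'X^(w i)) n.

HB.instance Definition _ := GRing.RMorphism.copy wgrad
  (@meval k _ (polyC \o @mconst k n) (fun i => mvar k n i *: 'X^(w i)) n).

Lemma wgradC c : wgrad (mconst n c) = (mconst n c)%:P.
Proof. by rewrite /wgrad /= meval_mconst. Qed.

Lemma wgrad_mvar i : (i < n)%N -> wgrad (mvar k n i) = mvar k n i *: 'X^(w i).
Proof. by move=> ltin; rewrite /wgrad /= meval_mvar. Qed.

Lemma wgrad1 p : (wgrad p).[1] = p.
Proof.
apply: (@rmorph_mpoly_ext _ _ _ (horner_eval 1 \o wgrad) idfun) => [c|i ltin] /=.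
  by rewrite wgradC /horner_eval hornerC.
by rewrite wgrad_mvar // /horner_eval hornerZ hornerXn expr1n mulr1.
Qed.

(** Both sides are degree [d] coefficients of ring morphisms into polynomials in two new variables:
    [F1] grades twice, [F2] grades once and then substitutes the product of the two variables. They
    agree on generators. *)
Lemma wgrad_coef p d : wgrad (wgrad p)`_d = (wgrad p)`_d *: 'X^d.
Proof.
pose F1 : {rmorphism mpoly k n -> {poly {poly mpoly k n}}} := map_poly wgrad \o wgrad.
pose F2 : {rmorphism mpoly k n -> {poly {poly mpoly k n}}} :=
  horner_eval ('X%:P * 'X) \o (map_poly (polyC \o polyC) \o wgrad).
have E1 : (F1 p)`_d = wgrad (wgrad p)`_d by rewrite coef_map.
have E2 : (F2 p)`_d = (wgrad p)`_d *: 'X^d.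
  rewrite /F2 /= /horner_eval (@horner_coef_wide _ (size (wgrad p))) ?size_poly //.
  have -> : \sum_(i < size (wgrad p))
      (map_poly (polyC \o polyC) (wgrad p))`_i * ('X%:P * 'X) ^+ i
    = \poly_(i < size (wgrad p)) ((wgrad p)`_i *: 'X^i).
    rewrite poly_def; apply: eq_bigr => i _.
    rewrite coef_map /= -mul_polyC exprMn mulrA -rmorphXn -rmorphM /=.
    by rewrite -[in RHS]mul_polyC.
  by rewrite coef_poly; case: ltnP => // /(nth_default 0) ->; rewrite scale0r.
rewrite -E1 -E2 (@rmorph_mpoly_ext _ _ _ F1 F2) => [//|c|i ltin].
  by rewrite /F1 /F2 /= wgradC !map_polyC /horner_eval /= hornerC wgradC.
rewrite /F1 /F2 /= wgrad_mvar // /horner_eval -!mul_polyC !rmorphM !rmorphXn /=.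
rewrite !map_polyC !map_polyX /= wgrad_mvar // !hornerE.
by rewrite -mul_polyC exprMn mulrA polyCM rmorphXn.
Qed.

Lemma wgrad0 p : (forall i, (i < n)%N -> 0 < w i)%N -> (wgrad p)`_0 = mconst n (aug k n p).
Proof.
move=> w_gt0; rewrite -horner_coef0.
apply: (@rmorph_mpoly_ext _ _ _ (horner_eval 0 \o wgrad) (@mconst k n \o aug k n)) => [c|i ltin] /=.
  by rewrite wgradC /horner_eval hornerC meval_mconst.
rewrite wgrad_mvar // /horner_eval hornerZ hornerXn meval_mvar // rmorph0.
by rewrite expr0n gtn_eqF ?mulr0 ?w_gt0.
Qed.

End Grading.
Arguments wgrad : clear implicits.

Section ToricGrading.
Variables (k : fieldType) (m n : nat) (v : nat -> 'rV[int]_m).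

(** The degree of the monomial [t^a], used as weight of a variable that maps to it. *)
Definition tdeg (a : 'rV[int]_m) : nat := (\sum_j `|a 0%R j|)%N.

Lemma wgrad_tmon a : wgrad k m (fun=> 1%N) (tmon k a) = tmon k a *: 'X^(tdeg a).
Proof.
rewrite rmorph_prod /= -mul_polyC /tmon /tdeg rmorph_prod -prodrXr -big_split.
apply: eq_bigr => j _.
by rewrite rmorphXn /= wgrad_mvar // -mul_polyC exprMn rmorphXn expr1.
Qed.

(** With these weights the toric map preserves degrees, hence its kernel contains the components of
    its elements. *)
Lemma toric_map_wgrad p :
  map_poly (toric_map k v n) (wgrad k n (tdeg \o v) p)
  = wgrad k m (fun=> 1%N) (toric_map k v n p).
Proof.
apply: (@rmorph_mpoly_ext _ _ _ (map_poly (toric_map k v n) \o wgrad k n (tdeg \o v))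
  (wgrad k m (fun=> 1%N) \o toric_map k v n)) => [c|i ltin] /=.
  by rewrite wgradC map_polyC /= !meval_mconst wgradC.
rewrite wgrad_mvar // meval_mvar // wgrad_tmon -!mul_polyC rmorphM rmorphXn /=.
by rewrite map_polyC map_polyX /= meval_mvar.
Qed.

Hypothesis v_neq0 : forall i, (i < n)%N -> v i != 0.

Lemma aug_toric_map p : aug k m (toric_map k v n p) = aug k n p.
Proof.
apply: (@rmorph_mpoly_ext _ _ _ (aug k m \o toric_map k v n) (aug k n)) => [c|i ltin] /=.
  by rewrite !meval_mconst.
by rewrite !meval_mvar // aug_tmon ?v_neq0.
Qed.

Lemma gen_by_toric s :
  gen_by (fun p => toric_map k v n p = 0) s <->
  exists f : 'I_s -> mpoly k n, spans_ker (@mconst k n) (aug k n) (toric_map k v n) f.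
Proof.
split=> [|[f]]; first by apply: gen_by_spans_ker => c; rewrite /= meval_mconst.
apply: (@graded_nakayama _ _ _ _ _ _ (wgrad k n (tdeg \o v))) => [p|p d|p|p d vp].
- exact: wgrad1.
- exact: wgrad_coef.
- apply: wgrad0 => i ltin /=; have [j nzj] := neq0_entry (v_neq0 ltin).
  by rewrite /tdeg (bigD1 j) //= addn_gt0 lt0n absz_eq0 nzj.
have := toric_map_wgrad p; rewrite [toric_map _ _ _ p]vp rmorph0 => /polyP/(_ d).
by rewrite coef_map coef0.
Qed.

End ToricGrading.

(** * Toric ideals with one more vector *)

Definition in_lattice (m n : nat) (v : nat -> 'rV[int]_m) (x : 'rV[int]_m) : Prop :=
  exists c : 'I_n -> int, x = \sum_(i < n) c i *: v i.

Section Lattice.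
Variables (m n : nat) (v : nat -> 'rV[int]_m).

Lemma in_lattice0 : in_lattice n v 0.
Proof. by exists (fun=> 0); rewrite big1 // => i _; rewrite scale0r. Qed.

Lemma in_latticeD x y : in_lattice n v x -> in_lattice n v y -> in_lattice n v (x + y).
Proof.
move=> [c ->] [d ->]; exists (fun i => c i + d i).
by rewrite -big_split; apply: eq_bigr => i _; rewrite scalerDl.
Qed.

Lemma in_latticeZ z x : in_lattice n v x -> in_lattice n v (z *: x).
Proof.
move=> [c ->]; exists (fun i => z * c i).
by rewrite scaler_sumr; apply: eq_bigr => i _; rewrite scalerA.
Qed.

Lemma in_lattice_mem i : (i < n)%N -> in_lattice n v (v i).
Proof.
move=> ltin; exists (fun j => (j == Ordinal ltin)%:R).
rewrite (bigD1 (Ordinal ltin)) //= eqxx scale1r big1 ?addr0 // => j /negPf->.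
by rewrite scale0r.
Qed.

End Lattice.

Section Steps.
Variables (k : fieldType) (m : nat).
Implicit Types v : nat -> 'rV[int]_m.

Definition toric_gen n v s := gen_by (fun p : mpoly k n => toric_map k v n p = 0) s.

Lemma toric_genP n v s : (forall i, (i < n)%N -> v i != 0) ->
  toric_gen n v s <->
  exists f : 'I_s -> mpoly k n, spans_ker (@mconst k n) (aug k n) (toric_map k v n) f.
Proof. by move=> nz; exact (gen_by_toric k nz s). Qed.

(** [F] renames variables by [sg] and [G] by [tau]; the toric map of [v'] after [F] is that of
    [v]. *)
Lemma toric_gen_perm n v v' (sg tau : nat -> nat) s :
    (forall i, (i < n)%N -> (sg i < n)%N) -> (forall i, (i < n)%N -> (tau i < n)%N) ->
    (forall i, (i < n)%N -> sg (tau i) = i) ->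
    (forall i, (i < n)%N -> v' (sg i) = v i) ->
  toric_gen n v s -> toric_gen n v' s.
Proof.
move=> sg_lt tau_lt tauK v'E.
pose F := @meval k _ (@mconst k n) (fun i => mvar k n (sg i)) n.
pose G := @meval k _ (@mconst k n) (fun i => mvar k n (tau i)) n.
have GK : cancel G F.
  apply: (@rmorph_mpoly_ext _ _ _ (F \o G) idfun) => [c|i ltin] /=.
    by rewrite /F /G !meval_mconst.
  by rewrite /F /G !meval_mvar ?tauK ?tau_lt.
have FE p : toric_map k v' n (F p) = toric_map k v n p.
  apply: (@rmorph_mpoly_ext _ _ _ (toric_map k v' n \o F) (toric_map k v n)) => [c|i ltin] /=.
    by rewrite /F !meval_mconst.
  by rewrite /F !meval_mvar ?sg_lt ?v'E.
apply: (gen_by_retract (F := F) (G := G)) => // [p|q|h q|p q|].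
- by rewrite FE.
- by rewrite -FE GK.
- by rewrite rmorphM /= => ->; rewrite mulr0.
- by rewrite rmorphD /= => -> ->; rewrite addr0.
- exact: rmorph0.
Qed.

(* Terms of [p] whose powers of the last variable have images in different
   cosets of the lattice [L] cannot cancel in the image of [p]. *)
Lemma toric_map_saturated n v (L : 'rV[int]_m -> Prop) (S : pred nat) (p : mpoly k n.+1) :
    (forall i, (i <= n)%N -> natvec (v i)) ->
    L 0 -> (forall x y, L x -> L y -> L (x + y)) -> (forall x, L x -> L (- x)) ->
    (forall i, (i < n)%N -> L (v i)) ->
    (forall i j : nat, L ((i%:Z - j%:Z) *: v n) -> S i -> S j) ->
  toric_map k v n.+1 p = 0 ->
  toric_map k v n.+1 (\poly_(j < size p) if S j then p`_j else 0) = 0.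
Proof.
move=> v_nat L0 LD LN Lv LS p0.
have Lq q : supported L (toric_map k v n q).
  apply: meval_closed q => [|x y|x y|c|i ltin].
  - exact: supported0.
  - exact: supportedD.
  - exact: supportedM.
  - by move=> u /supported_mconst->.
  - by move=> u /supported_tmon-> //; [apply: Lv | apply/v_nat/ltnW].
(* The term with the [j]-th power of the last variable has its exponents in the coset of [j] times
   [v n]. *)
have Lj q (j : nat) : supported (fun x => L (x - j%:Z *: v n))
    (toric_map k v n q * tmon k (v n) ^+ j).
  have Ltn := @supportedX _ _ _ _ j (@supported_tmon k _ _ (v_nat _ (leqnn n))).
  by apply: (supportedM _ (Lq q) Ltn) => x _ Lx ->; rewrite addrK.
rewrite meval_poly; apply: mcoef_inj0 => u; rewrite mcoef_sum.
pose E j := mcoef u (toric_map k v n p`_j * tmon k (v n) ^+ j).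
have sumE : \sum_(j < size p) E j = 0.
  transitivity (mcoef u (toric_map k v n.+1 p)); last by rewrite p0 mcoef0.
  by rewrite -[in RHS](coefK p) meval_poly mcoef_sum.
rewrite (eq_bigr (fun j : 'I_(size p) => if S j then E j else 0)); last first.
  by move=> j _; case: ifP => // _; rewrite rmorph0 mul0r mcoef0.
(* If a selected [j0] contributes at [u], every contributing [j] lies in the same coset and is
   selected too, so the restricted sum is the full one, which is 0. *)
have [j0 /andP[Sj0 nzj0]|E0] := pickP (fun j : 'I_(size p) => S j && (E j != 0)).
  rewrite -[RHS]sumE; apply: eq_bigr => j _; case: ifP => // /negP nSj.
  have [//|nzj] := eqVneq (E j) 0; case: nSj.
  apply: LS Sj0; have := LD _ _ (Lj _ _ _ nzj) (LN _ (Lj _ _ _ nzj0)).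
  by rewrite opprB addrC addrA subrK scalerBl.
by rewrite big1 // => j _; have := E0 j; case: ifP => //= _ /negbFE/eqP.
Qed.

Lemma tmonX_mul_eq0 (a : 'rV[int]_m) r (x : mpoly k m) : tmon k a ^+ r * x = 0 -> x = 0.
Proof.
move=> ax0; have reg : GRing.lreg (tmon k a ^+ r) by apply/lregX/lreg_tmon.
by apply: reg; rewrite mulr0.
Qed.

Section LastVector.
Variables (n : nat) (v : nat -> 'rV[int]_m).
Hypothesis v_nat : forall i, (i <= n)%N -> natvec (v i).
Hypothesis v_neq0 : forall i, (i <= n)%N -> v i != 0.

Lemma toric_map_saturated_lattice (S : pred nat) (p : mpoly k n.+1) :
    (forall i j : nat, in_lattice n v ((i%:Z - j%:Z) *: v n) -> S i -> S j) ->
  toric_map k v n.+1 p = 0 ->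
  toric_map k v n.+1 (\poly_(j < size p) if S j then p`_j else 0) = 0.
Proof.
apply: (toric_map_saturated (L := in_lattice n v)) => // [|x y|x|i].
- exact: in_lattice0.
- exact: in_latticeD.
- by rewrite -scaleN1r; apply: in_latticeZ.
- exact: in_lattice_mem.
Qed.

(** Distinct powers of the last variable lie in distinct cosets, so every coefficient of a kernel
    element is in the kernel for [n] vectors. One ideal is thus the extension of the other, and
    setting the last variable to 0 leads back. *)
Lemma toric_gen_free s :
    (forall i j : nat, in_lattice n v ((i%:Z - j%:Z) *: v n) -> i = j) ->
  toric_gen n.+1 v s <-> toric_gen n v s.
Proof.
move=> v_free.
have coef_ker (p : mpoly k n.+1) r : toric_map k v n.+1 p = 0 -> toric_map k v n p`_r = 0.
  move=> p0; have [ltrp|/(nth_default 0)->] := ltnP r (size p); last exact: rmorph0.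
  have := @toric_map_saturated_lattice (pred1 r) p.
  rewrite p0 meval_poly (bigD1 (Ordinal ltrp)) //= eqxx big1 => [|j /negPf nej].
    rewrite addr0 mulrC => /(_ _ (erefl _)) z; apply: (@tmonX_mul_eq0 (v n) r).
    by apply: z => i j /v_free->.
  by rewrite -[_ == r]/(j == Ordinal ltrp) nej rmorph0 mul0r.
split=> [|[g gP]].
  apply: (gen_by_retract (F := horner_eval 0) (G := polyC)) => [q|p|q|h q|p q|].
  - exact: hornerC.
  - by move/(coef_ker _ 0%N); rewrite /= /horner_eval horner_coef0.
  - by rewrite mevalC.
  - by rewrite rmorphM /= => ->; rewrite mulr0.
  - by rewrite rmorphD /= => -> ->; rewrite addr0.
  - exact: rmorph0.
exists (fun i => (g i)%:P) => p; split=> [p0|[h ->]]; last first.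
  rewrite rmorph_sum big1 // => i _; rewrite rmorphM /= mevalC.
  by have /gP /= -> := in_ideal_gen g (ltn_ord i); rewrite mulr0.
rewrite -[p]coefK poly_def; apply: in_ideal_sum => i _.
rewrite -mul_polyC mulrC; apply: in_idealM.
exact/(in_ideal_rmorph polyC)/gP/coef_ker.
Qed.

(** * Replacing the last vector by its multiple by [B] *)

Section Multiple.
Variables (B : nat) (v' : nat -> 'rV[int]_m).
Hypothesis B_gt0 : (0 < B)%N.
Hypothesis v'_last : v' n = B%:Z *: v n.
Hypothesis v'E : forall i, (i < n)%N -> v' i = v i.
Hypothesis v_period :
  forall i j : nat, in_lattice n v ((i%:Z - j%:Z) *: v n) -> (i %% B = j %% B)%N.

Lemma toric_map_comp_Xn (q : mpoly k n.+1) :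
  toric_map k v n.+1 (q \Po 'X^B) = toric_map k v' n.+1 q.
Proof.
apply: (@rmorph_mpoly_ext _ _ n.+1 (toric_map k v n.+1 \o comp_poly 'X^B) (toric_map k v' n.+1)).
  by move=> c /=; rewrite comp_polyC -[(mconst n c)%:P]/(mconst n.+1 c) !meval_mconst.
move=> i; rewrite ltnS leq_eqVlt => /= /predU1P[->|ltin].
  by rewrite eqxx comp_polyX rmorphXn /= !mevalX v'_last tmonZ.
by rewrite ltn_eqF // comp_polyC !mevalC !meval_mvar ?v'E.
Qed.

(** For [r < B]: the terms with exponent [r] modulo [B], divided by ['X^r] and rewritten with ['X]
    for ['X^B]. *)
Definition section_Xn r (p : {poly mpoly k n}) : {poly mpoly k n} :=
  \poly_(l < size p) p`_(r + B * l).

Lemma coef_section_Xn r p l : (section_Xn r p)`_l = p`_(r + B * l).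
Proof.
rewrite coef_poly; case: ltnP => // lepl; rewrite nth_default //.
by rewrite (leq_trans lepl) // (leq_trans (leq_pmull l B_gt0)) ?leq_addl.
Qed.

Lemma section_Xn_comp r p : (r < B)%N ->
  'X^r * (section_Xn r p \Po 'X^B) = \poly_(j < size p) if (j %% B == r)%N then p`_j else 0.
Proof.
move=> ltrB; apply/polyP => i; rewrite coefXnM coef_comp_poly_Xn // coef_poly.
have -> : (if (i < size p)%N then if (i %% B == r)%N then p`_i else 0 else 0)
        = if (i %% B == r)%N then p`_i else 0.
  by case: ltnP => // /(nth_default 0)->; rewrite if_same.
case: ltnP => [ltir|leri].
  by rewrite modn_small ?(ltn_trans ltir) // ltn_eqF.
rewrite -eqn_mod_dvd // (modn_small ltrB); case: eqP => // iBr.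
rewrite coef_section_Xn mulnC divnK ?subnKC //.
by rewrite -eqn_mod_dvd // (modn_small ltrB) iBr.
Qed.

(** The terms with exponent [r] modulo [B] form a saturated part of [p], hence lie in the ideal; the
    image of ['X^r] is a monomial and cancels. *)
Lemma toric_map_section_Xn r p : (r < B)%N ->
  toric_map k v n.+1 p = 0 -> toric_map k v' n.+1 (section_Xn r p) = 0.
Proof.
move=> ltrB p0; rewrite -toric_map_comp_Xn.
apply: (@tmonX_mul_eq0 (v n) r).
rewrite -(mevalX (@mconst k m) (fun i => tmon k (v i)) n) -rmorphXn -rmorphM /=.
rewrite section_Xn_comp //.
apply: (@toric_map_saturated_lattice (fun j => j %% B == r)%N) => // i j /v_period ->.
by [].
Qed.

Lemma section_Xn_zmod_morphism r : zmod_morphism (section_Xn r).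
Proof. by move=> p q; apply/polyP => i; rewrite coefB !coef_section_Xn coefB. Qed.

HB.instance Definition _ r :=
  GRing.isZmodMorphism.Build {poly mpoly k n} {poly mpoly k n} (section_Xn r)
    (section_Xn_zmod_morphism r).

Lemma section_XnC r c p : section_Xn r (c%:P * p) = c%:P * section_Xn r p.
Proof. by apply/polyP => i; rewrite coefCM !coef_section_Xn coefCM. Qed.

Lemma section_XnK q : section_Xn 0 (q \Po 'X^B) = q.
Proof.
apply/polyP => i; rewrite coef_section_Xn coef_comp_poly_Xn // add0n.
by rewrite dvdn_mulr // mulKn.
Qed.

Lemma section_XnX p : section_Xn 0 (p * 'X) = section_Xn B.-1 p * 'X.
Proof.
apply/polyP => -[|i]; rewrite coef_section_Xn !coefMX ?muln0 //= coef_section_Xn.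
by case: B B_gt0 => // b _; rewrite mulnS.
Qed.

(** A factor in [m] is written [h * 'X + c] with [c] vanishing at the origin. [section_Xn 0] keeps
    the factor [c], and turns the product with ['X] into ['X] times a [section_Xn B.-1]; in both
    cases the cofactor is a section of a kernel element. *)
Lemma section_Xn_mul_ker p :
    aug_mul_ker (aug k n.+1) (toric_map k v n.+1) p ->
  aug_mul_ker (aug k n.+1) (toric_map k v' n.+1) (section_Xn 0 p).
Proof.
elim=> [|h q r + q0 _ IHr]; first by rewrite raddf0; left.
rewrite raddfD /= => h0; apply: aug_mul_ker_add IHr.
elim/poly_ind: h h0 => [_|h c _ hc0]; first by rewrite mul0r raddf0; left.
have c0 : aug k n c = 0.
  by move: hc0; rewrite rmorphD rmorphM /= mevalC mevalX mulr0 add0r.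
rewrite mulrDl raddfD /= section_XnC mulrAC section_XnX [_ * 'X]mulrC.
apply: aug_mul_ker_add; apply: aug_mul_kerM.
- by rewrite /= mevalX.
- by apply: toric_map_section_Xn; rewrite ?ltn_predL // rmorphM /= q0 mulr0.
- by rewrite /= mevalC.
- exact: toric_map_section_Xn.
Qed.

(** From [v] to [v']: [section_Xn 0] undoes the substitution of ['X^B] and respects [m I], so it
    carries spanning families to spanning families. From [v'] to [v]: an element is the sum over
    residues [r] of ['X^r] times its section at ['X^B], and each section lies in the ideal of
    [v']. *)
Lemma toric_gen_multiple s : toric_gen n.+1 v s <-> toric_gen n.+1 v' s.
Proof.
have v'_neq0 i : (i < n.+1)%N -> v' i != 0.
  rewrite ltnS leq_eqVlt => /predU1P[->|ltin]; last by rewrite v'E ?v_neq0 // ltnW.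
  have [j] := neq0_entry (v_neq0 (leqnn n)); rewrite v'_last; apply: contraNneq => /rowP/(_ j).
  by rewrite !mxE => /eqP; rewrite mulf_eq0 eqz_nat (gtn_eqF B_gt0).
split=> [/toric_genP[//|f [kf sf]]|[g gP]].
  apply/toric_genP => //; exists (section_Xn 0 \o f); split=> [i|q q0].
    exact: (toric_map_section_Xn B_gt0 (kf i)).
  have [|a /section_Xn_mul_ker] := sf (q \Po 'X^B).
    exact: etrans (toric_map_comp_Xn q) q0.
  rewrite raddfB raddf_sum /= section_XnK; exists a.
  by under eq_bigr => i _ do rewrite -section_XnC.
exists (fun i => g i \Po 'X^B) => p; split=> [p0|[h ->]]; last first.
  rewrite rmorph_sum big1 // => i _; rewrite rmorphM /= toric_map_comp_Xn.
  by have /gP /= -> := in_ideal_gen g (ltn_ord i); rewrite mulr0.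
have -> : p = \sum_(r < B) 'X^r * (section_Xn r p \Po 'X^B).
  apply/polyP => i; rewrite coef_sum.
  rewrite (bigD1 (Ordinal (ltn_pmod i B_gt0))) //= section_Xn_comp ?ltn_pmod //.
  rewrite coef_poly eqxx big1 => [|r /negPf ner].
    by rewrite addr0; case: ltnP => // /(nth_default 0).
  rewrite section_Xn_comp // coef_poly; case: ifP => // _; case: eqP => // iBr.
  by case/eqP: ner; apply: val_inj.
apply: in_ideal_sum => r _; apply: in_idealM.
exact/(in_ideal_rmorph (comp_poly 'X^B))/gP/toric_map_section_Xn.
Qed.

End Multiple.

(** * A last vector whose monomial is already the image of some [M] *)

Section Redundant.
Variable M : mpoly k n.
Hypothesis toric_M : toric_map k v n M = tmon k (v n).

Lemma toric_map_horner (p : mpoly k n.+1) : toric_map k v n p.[M] = toric_map k v n.+1 p.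
Proof.
apply: (@rmorph_mpoly_ext _ _ n.+1 (toric_map k v n \o horner_eval M) (toric_map k v n.+1)).
  move=> c; rewrite /= /horner_eval hornerC -[(mconst n c)%:P]/(mconst n.+1 c).
  by rewrite !meval_mconst.
move=> i; rewrite ltnS leq_eqVlt /= /horner_eval => /predU1P[->|ltin].
  by rewrite eqxx hornerX mevalX.
by rewrite ltn_eqF // hornerC mevalC.
Qed.

Lemma toric_map_sub_monomial : toric_map k v n.+1 ('X - M%:P) = 0.
Proof. by rewrite -toric_map_horner !hornerE subrr rmorph0. Qed.

Lemma aug_monomial : aug k n M = 0.
Proof.
rewrite -(aug_toric_map (v := v)) => [|i ltin]; last exact/v_neq0/ltnW.
by rewrite toric_M aug_tmon ?v_neq0.
Qed.

(** [p - p.[M]] is a multiple of ['X - M], and [p.[M]] lies in the ideal of the first [n]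
    vectors. *)
Lemma toric_gen_add_redundant s : toric_gen n v s -> toric_gen n.+1 v s.+1.
Proof.
move=> [g gP]; pose g' i := if i is i'.+1 then (g i')%:P else 'X - M%:P.
exists g' => p; split=> [p0|[h ->]]; last first.
  rewrite rmorph_sum big1 // => -[[|i] lti] _; rewrite rmorphM /=.
    by rewrite toric_map_sub_monomial mulr0.
  by rewrite mevalC; have /gP /= -> := in_ideal_gen g (lti : (i < s)%N); rewrite mulr0.
rewrite -[p](subrK p.[M]%:P); apply: in_idealD.
  have /factor_theorem[q ->] : root (p - p.[M]%:P) M by rewrite /root !hornerE subrr.
  exact/in_idealM/(@in_ideal_gen _ g' s.+1 0).
have /gP/(in_ideal_rmorph polyC) : toric_map k v n p.[M] = 0 by rewrite toric_map_horner.
apply: in_ideal_sub => i ltis; exact: (@in_ideal_gen _ g' s.+1 i.+1).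
Qed.

Lemma aug_coef0 (p : mpoly k n.+1) : aug k n.+1 p = aug k n p`_0.
Proof. by rewrite mevalS horner_coef0 coef_map. Qed.

(* Vanishes on [m I] and takes the value 1 on ['X - M], which is therefore
   a minimal generator. *)
Let lin (p : mpoly k n.+1) : k := aug k n p`_1.

(** The coefficient of ['X] in [h * q] is [h_0 q_1 + h_1 q_0], and both constant coefficients vanish
    at the origin, that of [q] because the toric ideal lies in [m]. *)
Lemma lin_mul_ker p : aug_mul_ker (aug k n.+1) (toric_map k v n.+1) p -> lin p = 0.
Proof.
rewrite /lin; elim=> [|h q r h0 q0 _ IHr]; first by rewrite coef0 rmorph0.
rewrite coefD rmorphD /= IHr addr0 coefM !big_ord_recl big_ord0 addr0 /=.
rewrite rmorphD !rmorphM /= -aug_coef0 h0 mul0r add0r.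
rewrite (_ : aug k n q`_(_) = 0) ?mulr0 // -[X in q`_X]/0%N -aug_coef0.
rewrite -(aug_toric_map (v := v)) => [|i]; last by rewrite ltnS; apply: v_neq0.
by rewrite q0 rmorph0.
Qed.

Lemma horner_mul_ker p :
    aug_mul_ker (aug k n.+1) (toric_map k v n.+1) p ->
  aug_mul_ker (aug k n) (toric_map k v n) p.[M].
Proof.
elim=> [|h q r h0 q0 _ IHr]; first by rewrite horner0; left.
rewrite hornerD hornerM; apply: aug_mul_kerD => //; last exact: etrans (toric_map_horner q) q0.
apply: etrans h0.
apply: (@rmorph_mpoly_ext _ _ n.+1 (aug k n \o horner_eval M) (aug k n.+1)).
  move=> c; rewrite /= /horner_eval hornerC -[(mconst n c)%:P]/(mconst n.+1 c).
  by rewrite !meval_mconst.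
move=> i; rewrite ltnS leq_eqVlt /= /horner_eval => /predU1P[->|ltin].
  by rewrite eqxx hornerX mevalX aug_monomial.
by rewrite ltn_eqF // hornerC mevalC.
Qed.

Lemma toric_gen_redundant_gt0 : ~ toric_gen n.+1 v 0.
Proof.
move=> [g /(_ ('X - M%:P)) [/(_ toric_map_sub_monomial)[h]]].
by rewrite big_ord0 => /eqP; rewrite polyXsubC_eq0.
Qed.

Lemma toric_gen_del_redundant s : toric_gen n.+1 v s.+1 -> toric_gen n v s.
Proof.
case/toric_genP => [i ltin|f [kf sf]]; first exact: v_neq0.
apply/toric_genP => [i ltin|]; first exact/v_neq0/ltnW.
have [d dP] := sf _ toric_map_sub_monomial.
have [i0 nzd] : exists i0, d i0 != 0.
  apply/existsP; apply: contraT; rewrite negb_exists => /forallP d0.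
  have := lin_mul_ker dP; rewrite big1 => [|i _]; last first.
    by have /negPn/eqP -> := d0 i; rewrite rmorph0 mul0r.
  rewrite subr0 /lin coefB coefX coefC subr0 rmorph1 => /eqP.
  by rewrite oner_eq0.
have hE p (a : 'I_s.+1 -> k) : (p - \sum_i (mconst n.+1 (a i) : {poly mpoly k n}) * f i).[M]
    = p.[M] - \sum_i mconst n (a i) * (f i).[M].
  rewrite hornerD hornerN horner_sum; congr (_ - _); apply: eq_bigr => i _.
  by rewrite hornerM hornerC.
exists ((fun i => (f i).[M]) \o lift i0); apply: (spans_ker_drop nzd).
  have := horner_mul_ker dP; rewrite [_.[M]]hE hornerD hornerX hornerN hornerC subrr sub0r.
  by move/(aug_mul_ker_mul (-1)); rewrite mulN1r opprK.
split=> [i|q q0]; first exact: etrans (toric_map_horner (f i)) (kf i).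
have [|a /horner_mul_ker] := sf q%:P; first by rewrite /= mevalC.
by rewrite [_.[M]]hE hornerC; exists a.
Qed.

End Redundant.

End LastVector.
End Steps.

(** * Lists of vectors *)

Section ToricLists.
Variables (k : fieldType) (m : nat).
Implicit Types (a : 'rV[int]_m) (A R : seq 'rV[int]_m).

Definition list_gen A s := toric_gen k (size A) (nth 0 A) s.

Lemma toric_ciP A : toric_ci k A <->
  list_gen A (size A - rkZ A) /\ forall s, list_gen A s -> (size A - rkZ A <= s)%N.
Proof.
have genP s : list_gen A s <-> exists gs, generates gs (@toric_ideal k m A) /\ size gs = s.
  exact: gen_by_generates.
split=> [[/genP ci_gen ci_min]|[/genP ci_gen ci_min]]; split=> //.
  by move=> s /genP[gs [/ci_min le <-]].
by move=> gs gsP; apply: ci_min; apply/genP; exists gs.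
Qed.

Lemma list_gen_perm A A' s : perm_eq A A' -> list_gen A s <-> list_gen A' s.
Proof.
suff one B B' : perm_eq B B' -> list_gen B s -> list_gen B' s.
  by move=> eqA; split; apply: one; rewrite // perm_sym.
move=> eqB; have := eqB; rewrite perm_sym => /(perm_iotaP 0)[Is eqIs defB'].
have szIs : size Is = size B by rewrite (perm_size eqIs) size_iota.
have uIs : uniq Is by rewrite (perm_uniq eqIs) iota_uniq.
have mIs i : (i \in Is) = (i < size B)%N by rewrite (perm_mem eqIs) mem_iota.
rewrite /list_gen -(perm_size eqB).
apply: (toric_gen_perm (sg := fun i => index i Is) (tau := nth 0%N Is)) => i ltiB.
- by rewrite -szIs index_mem mIs.
- by rewrite -mIs mem_nth ?szIs.
- by rewrite index_uniq ?szIs.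
by rewrite defB' (nth_map 0%N) ?nth_index ?index_mem ?mIs.
Qed.

Definition ratmx A := \matrix_(i < size A, j < m) ratvec A`_i 0 j.

Lemma row_ratmx A i : row i (ratmx A) = ratvec A`_i.
Proof. by apply/rowP => j; rewrite !mxE. Qed.

Lemma ratmx_sub A p (X : 'M[rat]_(p, m)) :
  reflect (forall a, a \in A -> (ratvec a <= X)%MS) (ratmx A <= X)%MS.
Proof.
apply: (iffP row_subP) => [AX a|AX i]; last by rewrite row_ratmx AX ?mem_nth.
case/(nthP 0) => i ltiA <-.
by have := AX (Ordinal ltiA); rewrite row_ratmx.
Qed.

Lemma rkZ_perm A A' : perm_eq A A' -> rkZ A = rkZ A'.
Proof.
suff le (B B' : seq 'rV[int]_m) : perm_eq B B' -> (rkZ B <= rkZ B')%N.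
  by move=> eqA; apply/eqP; rewrite eqn_leq !le // perm_sym.
move=> eqB; apply: (mxrankS (A := ratmx B) (B := ratmx B')); apply/ratmx_sub => b.
rewrite (perm_mem eqB) => B'b.
exact: (ratmx_sub B' (ratmx B') (submx_refl _)).
Qed.

Lemma toric_ci_perm A A' : perm_eq A A' -> toric_ci k A <-> toric_ci k A'.
Proof.
move=> eqA; split=> /toric_ciP[ci_gen ci_min]; apply/toric_ciP.
  rewrite -(perm_size eqA) -(rkZ_perm eqA); split; first exact/(list_gen_perm _ eqA).
  by move=> s /(list_gen_perm _ eqA); apply: ci_min.
rewrite (perm_size eqA) (rkZ_perm eqA); split; first exact/(list_gen_perm _ eqA).
by move=> s /(list_gen_perm _ eqA); apply: ci_min.
Qed.

Lemma inQP a R : inQ a R <-> (ratvec a <= ratmx R)%MS.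
Proof.
split=> [[c ->]|/submxP[D defa]].
  by apply: summx_sub => i _; rewrite -row_ratmx scalemx_sub ?row_sub.
exists (D 0); rewrite defa mulmx_sum_row.
by apply: eq_bigr => i _; rewrite row_ratmx.
Qed.

Lemma ratvecZ z a : ratvec (z *: a) = z%:~R *: ratvec a.
Proof. by apply/rowP => j; rewrite !mxE intrM. Qed.

Lemma ratvec_sum (I : Type) (r : seq I) (E : I -> 'rV[int]_m) :
  ratvec (\sum_(i <- r) E i) = \sum_(i <- r) ratvec (E i).
Proof. exact: (raddf_sum (map_mx intr)). Qed.

Lemma ratvec_inj : injective (@ratvec m).
Proof.
move=> a b /rowP eqab; apply/rowP => j.
by have := eqab j; rewrite !mxE => /intr_inj.
Qed.

Lemma inZ_inQ a R (z : int) : z != 0 -> inZ (z *: a) R -> inQ a R.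
Proof.
move=> nz [c /(congr1 (@ratvec m))]; rewrite ratvecZ ratvec_sum => defa.
apply/inQP; rewrite -(@eqmx_scale _ _ _ z%:~R) ?intr_eq0 // defa.
by apply: summx_sub => i _; rewrite ratvecZ -row_ratmx scalemx_sub ?row_sub.
Qed.

Lemma inQ_inZ a R : inQ a R -> exists b : nat, (0 < b)%N /\ inZ (b%:Z *: a) R.
Proof.
move=> [c defa].
pose z i := numq (c i) * \prod_(j < size R | j != i) denq (c j).
have D_gt0 : 0 < \prod_(j < size R) denq (c j).
  by apply: prodr_gt0 => j _; apply: denq_gt0.
exists (absz (\prod_(j < size R) denq (c j))); split; first by rewrite absz_gt0 gt_eqF.
rewrite gez0_abs ?ltW //; exists z; apply: ratvec_inj.
rewrite ratvecZ ratvec_sum defa scaler_sumr; apply: eq_bigr => i _.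
rewrite ratvecZ scalerA; congr (_ *: _).
rewrite (bigD1 i) //= !intrM mulrAC; congr (_ * _).
by rewrite -{2}[c i]divq_num_den mulrC divfK // intr_eq0 denq_eq0.
Qed.

Lemma inZD x y R : inZ x R -> inZ y R -> inZ (x + y) R.
Proof. by move=> Zx Zy; exact (in_latticeD Zx Zy). Qed.

Lemma inZZ z x R : inZ x R -> inZ (z *: x) R.
Proof. by move=> Zx; exact (in_latticeZ z Zx). Qed.

Lemma decPP (P : Prop) : reflect P (Defs.decP P).
Proof. by rewrite /Defs.decP; destruct (excluded_middle_informative P); constructor. Qed.

Lemma ZmultP a R b : Zmult a R b <-> (0 < b)%N /\ inZ (b%:Z *: a) R.
Proof. by split=> /decPP. Qed.

(** Euclidean division: the remainder of [z] modulo [Bmin a R] is again a multiplier, smaller than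
    the minimum, hence 0. *)
Lemma BminP a R : inQ a R ->
  (0 < Bmin a R)%N /\
  forall z : int, inZ (z *: a) R -> (Posz (Bmin a R) %| z)%Z.
Proof.
move=> /inQ_inZ[b /ZmultP bP]; rewrite /Bmin.
destruct (excluded_middle_informative _) as [exb|[]]; last by exists b.
case: ex_minnP => B /ZmultP[B_gt0 ZB] B_min; split=> // z Zz.
have Zmod : inZ ((z %% B)%Z *: a) R.
  rewrite /modz scalerBl -scaleNr; apply: inZD => //.
  by rewrite scaleNr -scalerA -scaleN1r; apply/inZZ/inZZ.
apply/dvdz_mod0P; apply/eqP; apply: contraT => nz.
have mod_ge0 : 0 <= (z %% B)%Z by rewrite modz_ge0 // eqz_nat gtn_eqF.
have /B_min : Zmult a R `|(z %% B)%Z|%N by apply/ZmultP; rewrite absz_gt0 nz gez0_abs.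
by rewrite leqNgt -ltz_nat gez0_abs // ltz_pmod.
Qed.

Lemma rkZ_rcons R a : rkZ (rcons R a) = \rank (ratmx R + ratvec a)%MS.
Proof.
rewrite /rkZ -/(ratmx _); apply/eqmx_rank/andP; split.
  apply/ratmx_sub => b; rewrite mem_rcons inE => /predU1P[->|Rb]; first exact: addsmxSr.
  exact: submx_trans (ratmx_sub _ _ (submx_refl _) _ Rb) (addsmxSl _ _).
have sub b : b \in rcons R a -> (ratvec b <= ratmx (rcons R a))%MS.
  exact: ratmx_sub.
rewrite addsmx_sub sub ?mem_rcons ?mem_head // andbT.
by apply/ratmx_sub => b Rb; apply: sub; rewrite mem_rcons inE Rb orbT.
Qed.

Lemma rkZ_rcons_in R a : inQ a R -> rkZ (rcons R a) = rkZ R.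
Proof. by move=> /inQP/addsmx_idPl Ra; rewrite rkZ_rcons Ra. Qed.

Lemma rkZ_rcons_notin R a : ~ inQ a R -> rkZ (rcons R a) = (rkZ R).+1.
Proof.
move=> nRa; have nza : ratvec a != 0.
  by apply: contra_notN nRa => /eqP a0; apply/inQP; rewrite a0 sub0mx.
rewrite rkZ_rcons mxrank_disjoint_sum ?rank_rV ?nza ?addn1 //.
(* A nonzero intersection with the line through [a] would be the whole line. *)
apply/eqP; rewrite -mxrank_eq0; apply: contraT; rewrite -lt0n => cap_gt0.
case: nRa; apply/inQP; have : (ratmx R :&: ratvec a == ratvec a)%MS.
  rewrite -(mxrank_leqif_eq (capmxSr _ _)) eqn_leq mxrankS ?capmxSr //.
  by rewrite rank_rV nza.
by move=> /eqmxP <-; apply: capmxSl.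
Qed.

Lemma rkZ_le_size R : (rkZ R <= size R)%N.
Proof. exact: rank_leq_row. Qed.

End ToricLists.

(** * The reduction procedure *)

Section Reduction.
Variables (k : fieldType) (m : nat).
Implicit Types (a : 'rV[int]_m) (A R : seq 'rV[int]_m).

Lemma natvec_scale (b : nat) a : natvec a -> natvec (b%:Z *: a).
Proof. by move/forallP=> a0; apply/forallP => j; rewrite mxE mulr_ge0. Qed.

Lemma scale_neq0 (b : nat) a : (0 < b)%N -> a != 0 -> b%:Z *: a != 0.
Proof.
move=> b_gt0 /neq0_entry[j nzj]; apply/eqP => /rowP/(_ j)/eqP.
by rewrite !mxE mulf_eq0 (negPf nzj) orbF eqz_nat (gtn_eqF b_gt0).
Qed.

Definition nat_nonzero R := forall a, a \in R -> natvec a /\ a != 0.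

Lemma nat_nonzero_rcons R a :
  nat_nonzero R -> natvec a /\ a != 0 -> nat_nonzero (rcons R a).
Proof. by move=> R0 a0 b; rewrite mem_rcons inE => /predU1P[->|/R0]. Qed.

Lemma nth_rcons_nat_nonzero R a i : nat_nonzero (rcons R a) -> (i <= size R)%N ->
  natvec (nth 0 (rcons R a) i) /\ nth 0 (rcons R a) i != 0.
Proof. by move=> R0 lei; apply/R0/mem_nth; rewrite size_rcons ltnS. Qed.

Lemma nth_rcons_lt R a i : (i < size R)%N -> nth 0 (rcons R a) i = nth 0 R i.
Proof. by rewrite nth_rcons => ->. Qed.

Lemma nth_rcons_last R a : nth 0 (rcons R a) (size R) = a.
Proof. by rewrite nth_rcons ltnn eqxx. Qed.

Lemma in_lattice_rcons R a x :
  in_lattice (size R) (nth 0 (rcons R a)) x -> inZ x R.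
Proof.
by move=> [c ->]; exists c; apply: eq_bigr => i _; rewrite nth_rcons_lt.
Qed.

Lemma toric_gen_rcons R a s :
  toric_gen k (size R) (nth 0 (rcons R a)) s <-> list_gen k R s.
Proof.
split; apply: (toric_gen_perm (sg := id) (tau := id)) => // i lti.
  by rewrite nth_rcons_lt.
by rewrite nth_rcons_lt.
Qed.

Lemma inN_monomial R x : (forall a, a \in R -> natvec a) -> inN x R ->
  exists M : mpoly k (size R), toric_map k (nth 0 R) (size R) M = tmon k x.
Proof.
move=> Rnat [c [c0 ->]].
exists (\prod_(i < size R) mvar k (size R) i ^+ `|c i|%N).
rewrite rmorph_prod /=.
suff [_ ->] : natvec (\sum_(i < size R) c i *: R`_i) /\
   tmon k (\sum_(i < size R) c i *: R`_i) = \prod_(i < size R) tmon k (c i *: R`_i).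
  by apply: eq_bigr => i _; rewrite rmorphXn /= meval_mvar // tmonZ.
apply: (big_ind2 (fun x p => natvec x /\ tmon k x = p)) => [|x1 p1 x2 p2 [x10 <-] [x20 <-]|i _].
- by split; [apply/forallP => j; rewrite mxE | apply: tmon0].
- rewrite tmonD //; split=> //; apply/forallP => j.
  by rewrite mxE addr_ge0 //; [move/forallP: x10 | move/forallP: x20].
by rewrite -(gez0_abs (c0 i)); split=> //; apply/natvec_scale/Rnat/mem_nth.
Qed.

Lemma list_gen_rcons_notin R a s : nat_nonzero (rcons R a) -> ~ inQ a R ->
  list_gen k (rcons R a) s <-> list_gen k R s.
Proof.
move=> R0 nQ; rewrite /list_gen size_rcons -[X in _ <-> X]/(list_gen k R s) -(toric_gen_rcons R a).
apply: toric_gen_free => [i /(nth_rcons_nat_nonzero R0)[]//|i j].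
move=> /in_lattice_rcons; rewrite nth_rcons_last => Zij.
apply/eqP; apply: contra_notT nQ => neij; apply: inZ_inQ Zij.
by rewrite subr_eq0 eqz_nat.
Qed.

Lemma list_gen_rcons_multiple R a s : nat_nonzero (rcons R a) -> inQ a R ->
  list_gen k (rcons R a) s <-> list_gen k (rcons R ((Bmin a R)%:Z *: a)) s.
Proof.
move=> R0 Qa; have [B_gt0 B_dvd] := BminP Qa.
rewrite /list_gen !size_rcons.
apply: (@toric_gen_multiple k m (size R) (nth 0 (rcons R a)) _ _ (Bmin a R)) => // [i|i||i lti|i j].
- by case/(nth_rcons_nat_nonzero R0).
- by case/(nth_rcons_nat_nonzero R0).
- by rewrite !nth_rcons_last.
- by rewrite !nth_rcons_lt.
move=> /in_lattice_rcons; rewrite nth_rcons_last => /B_dvd.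
by rewrite -eqz_mod_dvd !modz_nat eqz_nat => /eqP.
Qed.

(** Possible numbers of generators shift by one, and so do the heights, since [a] leaves the rank
    unchanged. Zero generators are excluded for the longer list because its ideal contains
    ['X - M]. *)
Lemma toric_ci_rcons_inN R a : nat_nonzero (rcons R a) -> inQ a R -> inN a R ->
  toric_ci k (rcons R a) <-> toric_ci k R.
Proof.
move=> R0 Qa Na.
have v0 i : (i <= size R)%N -> nth 0 (rcons R a) i != 0 by case/(nth_rcons_nat_nonzero R0).
have [|M0 M0E] := inN_monomial _ Na.
  by move=> b Rb; case: (R0 b); rewrite // mem_rcons inE Rb orbT.
have ME : toric_map k (nth 0 (rcons R a)) (size R) M0 = tmon k (nth 0 (rcons R a) (size R)).
  rewrite nth_rcons_last -M0E; apply: eq_meval => i lti.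
  by rewrite nth_rcons_lt.
have genS s : list_gen k (rcons R a) s.+1 <-> list_gen k R s.
  rewrite -(toric_gen_rcons R a) /list_gen size_rcons.
  by split; [apply: toric_gen_del_redundant ME _ | apply: toric_gen_add_redundant ME _].
have gen0 : ~ list_gen k (rcons R a) 0.
  by rewrite /list_gen size_rcons; apply: toric_gen_redundant_gt0 ME.
rewrite !toric_ciP size_rcons rkZ_rcons_in // subSn ?rkZ_le_size //.
split=> -[/genS ci_gen ci_min]; split=> // s.
  by move/genS/ci_min.
by case: s => [/gen0|s /genS/ci_min].
Qed.

Lemma eq_toric_ci R R' :
    (size R - rkZ R = size R' - rkZ R')%N ->
    (forall s, list_gen k R s <-> list_gen k R' s) ->
  toric_ci k R <-> toric_ci k R'.
Proof.
move=> eqh eqg; rewrite !toric_ciP eqh.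
by split=> -[/eqg ci_gen ci_min]; split=> // s /eqg/ci_min.
Qed.

Lemma inQ_scale z a R : inQ a R -> inQ (z *: a) R.
Proof. by move=> /inQP Qa; apply/inQP; rewrite ratvecZ scalemx_sub. Qed.

(** If [a] is in [QR], the argument passes through the list with [Ba] in place of [a]; when [Ba] is
    in [NR] it is then deleted. *)
Lemma toric_ci_red_step R a : nat_nonzero R -> a \in R ->
  nat_nonzero (red_step R a) /\ (toric_ci k R <-> toric_ci k (red_step R a)).
Proof.
move=> R0 Ra; have eqR : perm_eq R (rcons (rem a R) a).
  by rewrite perm_sym perm_rcons perm_sym perm_to_rem.
have R1a0 : nat_nonzero (rcons (rem a R) a) by move=> b; rewrite -(perm_mem eqR) => /R0.
have R10 : nat_nonzero (rem a R) by move=> b /mem_rem/R0.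
rewrite (toric_ci_perm k eqR) /red_step; set R1 := rem a R in R1a0 R10 *.
case: decPP => [Qa|nQa]; last first.
  split=> //; apply: eq_toric_ci => [|s]; last exact: list_gen_rcons_notin.
  by rewrite size_rcons rkZ_rcons_notin.
have [B_gt0 _] := BminP Qa; have [a_nat a_neq0] := R0 a Ra.
set Ba := _ *: a.
have RB0 : nat_nonzero (rcons R1 Ba).
  by apply: nat_nonzero_rcons => //; split; [apply: natvec_scale | apply: scale_neq0].
have QBa : inQ Ba R1 by apply: inQ_scale.
have ciB : toric_ci k (rcons R1 a) <-> toric_ci k (rcons R1 Ba).
  apply: eq_toric_ci => [|s]; last exact: list_gen_rcons_multiple.
  by rewrite !size_rcons !rkZ_rcons_in.
case: decPP => [NBa|_]; split=> //.
by rewrite ciB; apply: toric_ci_rcons_inN.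
Qed.

Lemma count_red_step R a b : (count_mem b (rem a R) <= count_mem b (red_step R a))%N.
Proof.
rewrite /red_step; case: ifP => // _; case: ifP => // _.
by rewrite -cats1 count_cat leq_addr.
Qed.

(** The vectors still to be treated must be present: [G] is contained in [R] as a multiset, and this
    persists because a step removes only one copy of the treated vector. *)
Lemma toric_ci_foldl G R :
    nat_nonzero R -> (forall b, count_mem b G <= count_mem b R)%N ->
  let R' := foldl (@red_step m) R G in
  nat_nonzero R' /\ (toric_ci k R <-> toric_ci k R').
Proof.
elim: G R => [|a G IHG] R R0 GR //=.
have Ra : a \in R by rewrite -has_pred1 has_count (leq_trans _ (GR a)) //= eqxx.
have [R'0 ->] := toric_ci_red_step R0 Ra.
apply: IHG => // b; apply: leq_trans (count_red_step R a b).
by have := GR b; rewrite (permP (perm_to_rem Ra)) /= leq_add2l.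
Qed.

Lemma toric_ci_iter A j : nat_nonzero A ->
  let A' := iter j (@red_pass m) A in
  nat_nonzero A' /\ (toric_ci k A <-> toric_ci k A').
Proof.
move=> A0; elim: j => [|j [Aj0 ciAj]] //=.
by rewrite ciAj; apply: toric_ci_foldl.
Qed.

Lemma toric_ci_nil : toric_ci k ([::] : seq 'rV[int]_m).
Proof.
apply/toric_ciP; split=> //; exists (fun=> 0) => p.
have toric_p : toric_map k (nth (0 : 'rV[int]_m) [::]) 0 p = 0 <-> p = 0.
  split=> [p0|->]; last exact: rmorph0.
  (* Evaluation at the origin is a left inverse of the embedding of constants, so the ideal in [k]
     is zero. *)
  have := congr1 (aug k m) (p0 : mconst m (p : k) = 0).
  by rewrite meval_mconst rmorph0.
rewrite toric_p; split=> [->|[h ->]]; first exact: in_ideal0.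
by rewrite big_ord0.
Qed.

End Reduction.

Theorem mainTheorem5 (k : fieldType) (m : nat) (A : seq 'rV[int]_m)
  (HA : forall a, a \in A -> natvec a /\ a != 0)
  (Ared : seq 'rV[int]_m) (Hred : is_Ared A Ared) :
  toric_ci k A <-> (Ared = [::] \/ toric_ci k Ared).
Proof.
have [K [_ [_ ->]]] := Hred.
(* The property is invariant under any number of passes, and an empty output has it as well. *)
rewrite (toric_ci_iter k K.+1 HA).2; split=> [|[->|//]]; first by right.
exact: toric_ci_nil.
Qed.
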